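(* Let $n\ge1$ and let $\mathbf{L}$ be a De~Morgan lattice. The Kalman prime $n$-filters on $\mathbf{L}$ are precisely the sets of the form $h^{-1}[G]$, where $\langle\mathbf{M},G\rangle=\boldsymbol{\mathcal{P}}_i\otimes\boldsymbol{\mathcal{K}}_j$ for some integers $0\le i,j\le n$ with $i+j=n$, and $h\colon\mathbf{L}\to\mathbf{M}$ is a De~Morgan lattice homomorphism.
   Context: A De~Morgan lattice is a distributive lattice with a unary $\neg$ satisfying $\neg\neg x=x$ and the De~Morgan laws. $\mathbf{DM}_1$ is the four-element De~Morgan lattice on $\{\mathsf f,\mathsf n,\mathsf b,\mathsf t\}$ with $\mathsf f<\mathsf n,\mathsf b<\mathsf t$, $\mathsf n,\mathsf b$ incomparable, $\neg\mathsf t=\mathsf f$, $\neg\mathsf n=\mathsf n$, $\neg\mathsf b=\mathsf b$. A structure is a pair (algebra, designated subset). $\boldsymbol{\mathcal{P}}_1$ is the structure on the subalgebra $\{\mathsf t,\mathsf b,\mathsf f\}$ with designated set $\{\mathsf t,\mathsf b\}$; $\boldsymbol{\mathcal{K}}_1$ is the structure on $\{\mathsf t,\mathsf n,\mathsf f\}$ with designated set $\{\mathsf t\}$. The dual product of structures $\langle\mathbf{A}_k,F_k\rangle$ is $\langle\prod_k\mathbf{A}_k,\bigcup_k\pi_k^{-1}[F_k]\rangle$. $\boldsymbol{\mathcal{P}}_i\otimes\boldsymbol{\mathcal{K}}_j$ denotes the dual product of $i$ copies of $\boldsymbol{\mathcal{P}}_1$ and $j$ copies of $\boldsymbol{\mathcal{K}}_1$.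 An $n$-filter is an upset $F$ such that for every non-empty finite $Y\subseteq L$: if $\bigwedge X\in F$ for all non-empty $X\subseteq Y$ with $|X|\le n$, then $\bigwedge Y\in F$. An upset $F$ is prime if $x\vee y\in F$ implies $x\in F$ or $y\in F$ (the empty set counts as prime). An upset $F$ is Kalman if $((x\wedge\neg x)\wedge z)\vee u\in F$ implies $((y\vee\neg y)\wedge z)\vee u\in F$ for all $x,y,z,u$. *)

(* Defs.v *)
From HB Require Import structures.
From mathcomp Require Import all_boot all_order.
From mathcomp Require Import finmap.
From mathcomp Require Import boolp classical_sets.

Set Implicit Arguments.
Unset Strict Implicit.
Unset Printing Implicit Defensive.

Import Order.TTheory.
Local Open Scope order_scope.

(* De Morgan lattices: no bounds are required, neither as constants nor as
   elements. *)

HB.mixin Record DistrLattice_isDeMorgan (d : Order.disp_t) T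
    of Order.DistrLattice d T := {
  dmneg : T -> T;
  dmnegK : involutive dmneg;
  dmnegI : forall x y : T, dmneg (x `&` y) = dmneg x `|` dmneg y;
  dmnegU : forall x y : T, dmneg (x `|` y) = dmneg x `&` dmneg y;
}.

#[short(type="deMorganType")]
HB.structure Definition DeMorgan (d : Order.disp_t) :=
  { T of DistrLattice_isDeMorgan d T & Order.DistrLattice d T }.

Definition dm_hom (d d' : Order.disp_t) (L : deMorganType d)
    (M : deMorganType d') (h : L -> M) : Prop :=
  [/\ {morph h : x y / x `&` y >-> x `&` y},
      {morph h : x y / x `|` y >-> x `|` y} &
      {morph h : x / dmneg x >-> dmneg x}].

Record structure (d : Order.disp_t) := Structure {
  algebra : deMorganType d;
  designated : set algebra
}.
Arguments Structure {d} algebra designated.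
Arguments designated {d} s.

Record subalgebra (d : Order.disp_t) (L : deMorganType d) := Subalgebra {
  subalg_pred : {pred L};
  subalgI : {in subalg_pred &, forall x y, x `&` y \in subalg_pred};
  subalgU : {in subalg_pred &, forall x y, x `|` y \in subalg_pred};
  subalgN : {in subalg_pred, forall x, dmneg x \in subalg_pred}
}.

Definition subalg_type (d : Order.disp_t) (L : deMorganType d)
  (S : subalgebra L) : Type := {x : L | x \in subalg_pred S}.

Section SubalgebraInstance.
Variables (d : Order.disp_t) (L : deMorganType d) (S : subalgebra L).
Local Notation U := (subalg_type S).
Implicit Types x y z : U.

HB.instance Definition _ := Choice.copy U {x : L | x \in subalg_pred S}.

Definition sub_meet x y : U :=
  exist _ (sval x `&` sval y) (subalgI (svalP x) (svalP y)).
Definition sub_join x y : U :=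
  exist _ (sval x `|` sval y) (subalgU (svalP x) (svalP y)).
Definition sub_neg x : U := exist _ (dmneg (sval x)) (subalgN (svalP x)).
Definition sub_le x y := sval x <= sval y.
Definition sub_lt x y := sval x < sval y.

Fact sub_le_def x y : sub_le x y = (sub_meet x y == x).
Proof. by rewrite /sub_le leEmeet. Qed.
Fact sub_lt_def x y : sub_lt x y = (y != x) && sub_le x y.
Proof. by rewrite /sub_lt lt_def. Qed.
Fact sub_meetC : commutative sub_meet.
Proof. by move=> x y; apply: val_inj; exact: meetC. Qed.
Fact sub_joinC : commutative sub_join.
Proof. by move=> x y; apply: val_inj; exact: joinC. Qed.
Fact sub_meetA : associative sub_meet.
Proof. by move=> x y z; apply: val_inj; exact: meetA. Qed.
Fact sub_joinA : associative sub_join.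
Proof. by move=> x y z; apply: val_inj; exact: joinA. Qed.
Fact sub_joinKI y x : sub_meet x (sub_join x y) = x.
Proof. by apply: val_inj; exact: joinKI. Qed.
Fact sub_meetKU y x : sub_join x (sub_meet x y) = x.
Proof. by apply: val_inj; exact: meetKU. Qed.
Fact sub_meetUl : left_distributive sub_meet sub_join.
Proof. by move=> x y z; apply: val_inj; exact: meetUl. Qed.
Fact sub_meetxx : idempotent_op sub_meet.
Proof. by move=> x; apply: val_inj; exact: meetxx. Qed.

HB.instance Definition _ := @Order.isMeetJoinDistrLattice.Build d U
  sub_le sub_lt sub_meet sub_join sub_le_def sub_lt_def sub_meetC sub_joinC
  sub_meetA sub_joinA sub_joinKI sub_meetKU sub_meetUl sub_meetxx.

Fact sub_negK : involutive sub_neg.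
Proof. by move=> x; apply: val_inj; exact: dmnegK. Qed.
Fact sub_negI x y : sub_neg (x `&` y) = sub_neg x `|` sub_neg y.
Proof. by apply: val_inj; exact: dmnegI. Qed.
Fact sub_negU x y : sub_neg (x `|` y) = sub_neg x `&` sub_neg y.
Proof. by apply: val_inj; exact: dmnegU. Qed.

HB.instance Definition _ :=
  @DistrLattice_isDeMorgan.Build d U sub_neg sub_negK sub_negI sub_negU.

End SubalgebraInstance.

Definition prod_type (d : Order.disp_t) (I : Type) (A : I -> deMorganType d) :
  Type := forall k, A k.

Section ProductInstance.
Variables (d : Order.disp_t) (I : Type) (A : I -> deMorganType d).
Local Notation U := (prod_type A).
Implicit Types x y z : U.

HB.instance Definition _ := gen_eqMixin U.
HB.instance Definition _ := gen_choiceMixin U.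

Definition prod_meet x y : U := fun k => x k `&` y k.
Definition prod_join x y : U := fun k => x k `|` y k.
Definition prod_neg x : U := fun k => dmneg (x k).
Definition prod_le x y := `[< forall k, x k <= y k >].
Definition prod_lt x y := (y != x) && prod_le x y.

Fact prod_le_def x y : prod_le x y = (prod_meet x y == x).
Proof.
apply/asboolP/eqP => [xy|xy k].
  by apply: functional_extensionality_dep => k; apply/meet_l/xy.
by rewrite leEmeet -[X in _ == X k]xy.
Qed.
Fact prod_lt_def x y : prod_lt x y = (y != x) && prod_le x y.
Proof. by []. Qed.
Fact prod_meetC : commutative prod_meet.
Proof.
by move=> x y; apply: functional_extensionality_dep => k; exact: meetC.
Qed.
Fact prod_joinC : commutative prod_join.
Proof.
by move=> x y; apply: functional_extensionality_dep => k; exact: joinC.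
Qed.
Fact prod_meetA : associative prod_meet.
Proof.
by move=> x y z; apply: functional_extensionality_dep => k; exact: meetA.
Qed.
Fact prod_joinA : associative prod_join.
Proof.
by move=> x y z; apply: functional_extensionality_dep => k; exact: joinA.
Qed.
Fact prod_joinKI y x : prod_meet x (prod_join x y) = x.
Proof. by apply: functional_extensionality_dep => k; exact: joinKI. Qed.
Fact prod_meetKU y x : prod_join x (prod_meet x y) = x.
Proof. by apply: functional_extensionality_dep => k; exact: meetKU. Qed.
Fact prod_meetUl : left_distributive prod_meet prod_join.
Proof.
by move=> x y z; apply: functional_extensionality_dep => k; exact: meetUl.
Qed.
Fact prod_meetxx : idempotent_op prod_meet.
Proof.
by move=> x; apply: functional_extensionality_dep => k; exact: meetxx.
Qed.

HB.instance Definition _ := @Order.isMeetJoinDistrLattice.Build d U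
  prod_le prod_lt prod_meet prod_join prod_le_def prod_lt_def
  prod_meetC prod_joinC prod_meetA prod_joinA prod_joinKI prod_meetKU
  prod_meetUl prod_meetxx.

Fact prod_negK : involutive prod_neg.
Proof.
by move=> x; apply: functional_extensionality_dep => k; exact: dmnegK.
Qed.
Fact prod_negI x y : prod_neg (x `&` y) = prod_neg x `|` prod_neg y.
Proof. by apply: functional_extensionality_dep => k; exact: dmnegI. Qed.
Fact prod_negU x y : prod_neg (x `|` y) = prod_neg x `&` prod_neg y.
Proof. by apply: functional_extensionality_dep => k; exact: dmnegU. Qed.

HB.instance Definition _ :=
  @DistrLattice_isDeMorgan.Build d U prod_neg prod_negK prod_negI prod_negU.

End ProductInstance.

Definition dual_product (d : Order.disp_t) (I : Type) (S : I -> structure d) :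
    structure d :=
  Structure (prod_type (fun k => algebra (S k)))
    (\bigcup_k ((fun x => x k) @^-1` designated (S k)))%classic.

Variant DM1 := dm_f | dm_n | dm_b | dm_t.

Definition dm1_code (x : DM1) : bool * bool :=
  match x with
  | dm_f => (false, false)
  | dm_n => (true, false)
  | dm_b => (false, true)
  | dm_t => (true, true)
  end.
Definition dm1_decode (c : bool * bool) : DM1 :=
  match c with
  | (false, false) => dm_f
  | (true, false) => dm_n
  | (false, true) => dm_b
  | (true, true) => dm_t
  end.
Fact dm1_codeK : cancel dm1_code dm1_decode. Proof. by case. Qed.

HB.instance Definition _ := Finite.copy DM1 (can_type dm1_codeK).

Definition dm1_meet (x y : DM1) : DM1 :=
  match x, y with
  | dm_t, z | z, dm_t => z
  | dm_n, dm_n => dm_n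
  | dm_b, dm_b => dm_b
  | _, _ => dm_f
  end.
Definition dm1_join (x y : DM1) : DM1 :=
  match x, y with
  | dm_f, z | z, dm_f => z
  | dm_n, dm_n => dm_n
  | dm_b, dm_b => dm_b
  | _, _ => dm_t
  end.
Definition dm1_le (x y : DM1) : bool :=
  match x, y with
  | dm_f, _ | _, dm_t | dm_n, dm_n | dm_b, dm_b => true
  | _, _ => false
  end.
Definition dm1_lt (x y : DM1) : bool := (y != x) && dm1_le x y.
Definition dm1_neg (x : DM1) : DM1 :=
  match x with
  | dm_f => dm_t
  | dm_n => dm_n
  | dm_b => dm_b
  | dm_t => dm_f
  end.

Fact dm1_le_def x y : dm1_le x y = (dm1_meet x y == x).
Proof. by case: x y => [] []. Qed.
Fact dm1_lt_def x y : dm1_lt x y = (y != x) && dm1_le x y.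
Proof. by []. Qed.
Fact dm1_meetC : commutative dm1_meet. Proof. by do 2!case. Qed.
Fact dm1_joinC : commutative dm1_join. Proof. by do 2!case. Qed.
Fact dm1_meetA : associative dm1_meet. Proof. by do 3!case. Qed.
Fact dm1_joinA : associative dm1_join. Proof. by do 3!case. Qed.
Fact dm1_joinKI y x : dm1_meet x (dm1_join x y) = x.
Proof. by case: x y => [] []. Qed.
Fact dm1_meetKU y x : dm1_join x (dm1_meet x y) = x.
Proof. by case: x y => [] []. Qed.
Fact dm1_meetUl : left_distributive dm1_meet dm1_join.
Proof. by do 3!case. Qed.
Fact dm1_meetxx : idempotent_op dm1_meet. Proof. by case. Qed.

HB.instance Definition _ :=
  @Order.isMeetJoinDistrLattice.Build (Order.Disp tt tt) DM1
    dm1_le dm1_lt dm1_meet dm1_join dm1_le_def dm1_lt_def dm1_meetC dm1_joinC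
    dm1_meetA dm1_joinA dm1_joinKI dm1_meetKU dm1_meetUl dm1_meetxx.

Fact dm1_negK : involutive dm1_neg. Proof. by case. Qed.
Fact dm1_negI (x y : DM1) : dm1_neg (x `&` y) = dm1_neg x `|` dm1_neg y.
Proof. by case: x y => [] []. Qed.
Fact dm1_negU (x y : DM1) : dm1_neg (x `|` y) = dm1_neg x `&` dm1_neg y.
Proof. by case: x y => [] []. Qed.

HB.instance Definition _ := @DistrLattice_isDeMorgan.Build
  (Order.Disp tt tt) DM1 dm1_neg dm1_negK dm1_negI dm1_negU.

Definition P1_pred : {pred DM1} := mem [:: dm_t; dm_b; dm_f].
Definition K1_pred : {pred DM1} := mem [:: dm_t; dm_n; dm_f].

Fact P1_predI : {in P1_pred &, forall x y, x `&` y \in P1_pred}.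
Proof. by do 2!case. Qed.
Fact P1_predU : {in P1_pred &, forall x y, x `|` y \in P1_pred}.
Proof. by do 2!case. Qed.
Fact P1_predN : {in P1_pred, forall x, dmneg x \in P1_pred}.
Proof. by case. Qed.
Fact K1_predI : {in K1_pred &, forall x y, x `&` y \in K1_pred}.
Proof. by do 2!case. Qed.
Fact K1_predU : {in K1_pred &, forall x y, x `|` y \in K1_pred}.
Proof. by do 2!case. Qed.
Fact K1_predN : {in K1_pred, forall x, dmneg x \in K1_pred}.
Proof. by case. Qed.

Definition P1_subalg := Subalgebra P1_predI P1_predU P1_predN.
Definition K1_subalg := Subalgebra K1_predI K1_predU K1_predN.

Definition P1 : structure (Order.Disp tt tt) :=
  Structure (subalg_type P1_subalg)
    [set x | sval x = dm_t \/ sval x = dm_b]%classic.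

Definition K1 : structure (Order.Disp tt tt) :=
  Structure (subalg_type K1_subalg) [set x | sval x = dm_t]%classic.

Definition PK (i j : nat) : structure (Order.Disp tt tt) :=
  dual_product
    (fun k : 'I_i + 'I_j => match k with inl _ => P1 | inr _ => K1 end).

Section Filters.
Variables (d : Order.disp_t) (L : deMorganType d).
Implicit Types (F : set L) (X Y : {fset L}).

Definition upset F : Prop := forall x y, F x -> x <= y -> F y.

(* The meet of a finite set X containing x0. There need be no top element to
   start the iteration from, so it starts from x0; by idempotence the value
   does not depend on the choice of x0 in X. *)
Definition fmeet X (x0 : L) : L := \big[Order.meet/x0]_(x <- X) x.

Lemma le_fmeet X x0 y :
  x0 \in X -> (y <= fmeet X x0) = all (fun x => y <= x) X.
Proof.
have E s : (y <= \big[Order.meet/x0]_(x <- s) x)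
           = (y <= x0) && all (fun x => y <= x) s.
  elim: s => [|a s IH] /=; first by rewrite big_nil andbT.
  by rewrite big_cons lexI IH andbCA.
move=> Xx0; rewrite /fmeet E andb_idl // => /allP; exact.
Qed.

Definition n_filter (n : nat) F : Prop :=
  upset F /\
  forall Y y0, y0 \in Y ->
    (forall X x0, x0 \in X -> (X `<=` Y)%fset -> (#|` X| <= n)%N ->
       F (fmeet X x0)) ->
    F (fmeet Y y0).

Definition prime_upset F : Prop :=
  upset F /\ forall x y, F (x `|` y) -> F x \/ F y.

Definition kalman F : Prop :=
  upset F /\
  forall x y z u, F (((x `&` dmneg x) `&` z) `|` u) ->
                  F (((y `|` dmneg y) `&` z) `|` u).

End Filters.

(* Main.v *)
Require Import Defs.
From mathcomp Require Import all_boot all_order.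
From mathcomp Require Import finmap.
From mathcomp Require Import boolp classical_sets.

(** Call elements [x 1, ..., x k] of [F] _orthogonal_ when no meet of two of
    them lies in [F].  A prime n-filter admits no orthogonal family of size
    n + 1: apply the n-filter condition to the joins of the [x j] with one index
    omitted.  For an orthogonal family of maximal size, each set
    [U i = {y | y /\ x i \in F}] is a prime filter, since otherwise [x i] could
    be split in two, and [F] is the union of the [U i], since otherwise the
    family could be extended.  The Kalman condition, applied with [z = x i],
    shows that each [U i] contains one of [y, ~ y] for every [y], or contains
    both for no [y]; these are the preimages of the designated sets of [P1] and
    of [K1] under homomorphisms.  Missing factors are supplied by the empty
    filter, the preimage under the constant map to [K1] with value [n]. *)

Set Implicit Arguments.
Unset Strict Implicit.
Unset Printing Implicit Defensive.

Import Order.TTheory.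
Local Open Scope order_scope.

(** * Prime filters, finite meets and joins *)

Section PrimeFilters.
Variables (d : Order.disp_t) (L : deMorganType d).
Implicit Types (F U : set L) (x y z u v w : L).

(* The empty set and the whole lattice are allowed. *)
Definition prime_filter U : Prop :=
  [/\ upset U, forall x y, U x -> U y -> U (x `&` y)
    & forall x y, U (x `|` y) -> U x \/ U y].

Definition neg_complete U : Prop := forall x, U x \/ U (dmneg x).
Definition neg_consistent U : Prop := forall x, ~ (U x /\ U (dmneg x)).

Lemma prime_filter0 : prime_filter set0.
Proof. by split=> x y []. Qed.

Lemma upset_meetl F x y : upset F -> F (x `&` y) -> F x.
Proof. by move=> Fup /Fup; apply; exact: leIl. Qed.

Lemma upset_meetr F x y : upset F -> F (x `&` y) -> F y.
Proof. by move=> Fup /Fup; apply; exact: leIr. Qed.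

Lemma prime_filterI U x y : prime_filter U -> U (x `&` y) <-> U x /\ U y.
Proof.
case=> Uup UI _; split=> [Uxy|[]]; last exact: UI.
by split; [exact: upset_meetl Uxy | exact: upset_meetr Uxy].
Qed.

Lemma prime_filterU U x y : prime_filter U -> U (x `|` y) <-> U x \/ U y.
Proof.
case=> Uup _ UU; split=> [/UU //|[] /Uup]; apply; [exact: leUl|exact: leUr].
Qed.

Lemma le_bigmeet (s : seq L) x0 x :
  x \in s -> \big[Order.meet/x0]_(y <- s) y <= x.
Proof.
elim: s => // a s IHs; rewrite inE big_cons => /predU1P[->|/IHs].
  exact: leIl.
exact/le_trans/leIr.
Qed.

Lemma le_bigjoin (I : finType) (P : pred I) (x : I -> L) x0 i :
  P i -> x i <= \big[Order.join/x0]_(j | P j) x j.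
Proof.
move=> Pi; have : i \in index_enum I by rewrite mem_index_enum.
elim: (index_enum I) => // a s IHs; rewrite inE big_cons.
move=> /predU1P[<-|/IHs]; first by rewrite Pi leUl.
by case: (P a) => // /le_trans; apply; exact: leUr.
Qed.

Lemma prime_filter_fmeet U (Y : {fset L}) y0 :
  prime_filter U -> y0 \in Y -> (forall y, y \in Y -> U y) -> U (fmeet Y y0).
Proof.
move=> [_ UI _] Yy0 UY; rewrite /fmeet big_seq.
by apply: big_ind => //; exact: UY.
Qed.

Lemma prime_upset_bigjoin F (I : finType) (P : pred I) (x : I -> L) i0 v :
    prime_upset F -> P i0 ->
    F (v `&` \big[Order.join/x i0]_(j | P j) x j) ->
  exists2 j, P j & F (v `&` x j).
Proof.
move=> [_ FU] Pi0; apply: (big_ind (fun w => F (v `&` w) -> exists2 j, _ & _)).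
- by exists i0.
- by move=> a b IHa IHb; rewrite meetUr => /FU[].
- by move=> i Pi Fi; exists i.
Qed.

(** * Orthogonal families and the decomposition of prime n-filters *)

Definition residual F z : set L := fun y => F (y `&` z).

Definition orthogonal F (I : eqType) (x : I -> L) : Prop :=
  (forall i, F (x i)) /\ (forall i j, i != j -> ~ F (x i `&` x j)).

Lemma prime_n_filter_orthogonal F m (x : 'I_m.+2 -> L) :
  n_filter m.+1 F -> prime_upset F -> ~ orthogonal F x.
Proof.
move=> [Fup Fn] Fp [Fx Fxx].
(* The join starts from the term at [lift i ord0], an index other than [i], so no bottom element is
   required. *)
pose y (i : 'I_m.+2) :=
  \big[Order.join/x (lift i (ord0 : 'I_m.+1))]_(j | i != j) x j.
have ley i j : i != j -> x j <= y i by move=> ij; rewrite /y; apply: le_bigjoin.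
pose Y := [fset y i | i in 'I_m.+2]%fset.
have Yy i : y i \in Y by rewrite in_imfset.
have : F (fmeet Y (y ord0)).
  apply: Fn => // X x0 Xx0 XY cX.
  have /choice[g gP] : forall z : X, exists i, val z = y i.
    by move=> z; have /imfsetP[i _ zi] := fsubsetP XY _ (valP z); exists i.
  (* At most [m.+1] elements of [X] are labelled by [g], so one of the [m.+2] indices is missed; its
     [x i] lies below every element of [X]. *)
  have [i ig] : exists i, i \notin codom g.
    apply: contrapT => /forallNP sg.
    have /uniq_leq_size : {subset enum 'I_m.+2 <= codom g}.
      by move=> i _; apply/negPn/negP/sg.
    rewrite enum_uniq size_enum_ord size_codom -cardfE => /(_ isT) mX.
    by have := leq_trans mX cX; rewrite ltnn.
  apply: (Fup (x i)) => //; rewrite le_fmeet //; apply/allP => z Xz.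
  have -> : z = y (g [` Xz]%fset) by rewrite -gP.
  apply: ley; apply: contraNneq ig => <-; exact: codom_f.
have Ymeet i : fmeet Y (y ord0) <= y i by exact: le_bigmeet.
(* Distributing over [y ord0] produces [x j]; distributing next over [y j] produces [x l] with
   [l != j], so the meet of [x j] and [x l] is in [F]. *)
rewrite -(meet_l (Ymeet ord0)) => /(prime_upset_bigjoin Fp)[|j _ Fj].
  exact: neq_lift.
have : F (fmeet Y (y ord0) `&` x j `&` y j).
  by rewrite meetAC (meet_l (Ymeet j)).
move=> /(prime_upset_bigjoin Fp)[|l jl]; first exact: neq_lift.
by rewrite -meetA => /(upset_meetr Fup); exact: Fxx.
Qed.

Lemma orthogonal_extend F k (x : 'I_k -> L) y :
    orthogonal F x -> F y -> (forall i, ~ F (x i `&` y)) ->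
  exists x' : 'I_k.+1 -> L, orthogonal F x'.
Proof.
move=> [Fx Fxx] Fy Fxy.
exists (fun i => if unlift ord0 i is Some j then x j else y); split=> [i|i j].
  by case: unliftP.
case: unliftP => [i' ->|->]; case: unliftP => [j' ->|->].
- by rewrite (inj_eq lift_inj) => /Fxx.
- by move=> _; exact: Fxy.
- by move=> _; rewrite meetC; exact: Fxy.
- by rewrite eqxx.
Qed.

Lemma maximal_orthogonal_prime_filter F k (x : 'I_k -> L) i :
    prime_upset F -> orthogonal F x ->
    ~ (exists x' : 'I_k.+1 -> L, orthogonal F x') ->
  prime_filter (residual F (x i)).
Proof.
move=> [Fup FU] [Fx Fxx] xmax; split=> [a b Fa ab|a b Fa Fb|a b].
- by apply: Fup Fa _; exact: leI2.
- apply: contrapT => Fab; apply: xmax.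
  (* Split [x i]: its meet with [a] replaces it and its meet with [b] is appended. These two are
     orthogonal by [Fab]; the other pairs stay so because passing to smaller elements cannot bring a
     meet into an upset. *)
  pose x' j := if j == i then a `&` x i else x j.
  have lex' j : x' j <= x j.
    by rewrite /x'; case: eqP => // ->; exact: leIr.
  apply: (orthogonal_extend (x := x') (y := b `&` x i)) => //.
    split=> [j|j l jl Fjl]; first by rewrite /x'; case: eqP.
    by apply: (Fxx _ _ jl); apply: Fup Fjl _; exact: leI2.
  move=> j; have [->|ji] := eqVneq j i.
    by rewrite /x' eqxx meetACA meetxx.
  move=> Fj; apply: (Fxx _ _ ji); apply: Fup Fj _.
  by apply: leI2 => //; exact: leIr.
- by rewrite /residual meetUl => /FU.
Qed.

Lemma kalman_neg F z :
    kalman F -> prime_filter (residual F z) ->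
  neg_complete (residual F z) \/
  neg_consistent (residual F z).
Proof.
move=> [_ Fkal] [_ UI UU].
have [|/existsNP[x Ux]] := pselect (neg_consistent (residual F z)); [by right|].
have {Ux}[Ux Unx] := contrapT Ux.
left=> y; apply: UU; have Fx := UI _ _ Ux Unx.
(* Taken as [u], this stands in for a bottom element: it lies below both sides of the Kalman
   condition and is absorbed by each. *)
pose v := (x `&` dmneg x `&` z) `&` ((y `|` dmneg y) `&` z).
have := Fkal x y z v; rewrite /v meetKU meetKUC; exact.
Qed.

Lemma kalman_prime_n_filter_bigcup F n :
    (0 < n)%N -> n_filter n F -> prime_upset F -> kalman F ->
  exists U : 'I_n -> set L,
    [/\ forall i, prime_filter (U i),
        forall i, neg_complete (U i) \/ neg_consistent (U i)
      & F = (\bigcup_i U i)%classic].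
Proof.
case: n => // m _ Fn Fp Fkal; have [Fup _] := Fp.
pose ortho k := exists x : 'I_k -> L, orthogonal F x.
have [k [km [x Fx] xmax]] : exists k, [/\ (k <= m.+1)%N, ortho k & ~ ortho k.+1].
  have : ~ ortho m.+2 by case=> x; exact: prime_n_filter_orthogonal.
  (* Descending search; it ends at the latest with the empty family, which is the case of empty
     [F]. *)
  elim: m.+1 => [|k IHk] nok.
    exists 0%N; split=> //.
    have x0 : 'I_0 -> L by case.
    by exists x0; split; case.
  have [ok|/IHk[j [jk oj noj]]] := pselect (ortho k.+1); first by exists k.+1.
  by exists j; split=> //; exact: leqW.
pose U i := residual F (x i).
have Upf i : prime_filter (U i) by exact: maximal_orthogonal_prime_filter.
(* Pads the [k] filters with empty ones up to exactly [m.+1]. *)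
pose V (i : 'I_m.+1) := if insub (val i) is Some j then U j else set0.
exists V; split=> [i|i|].
- by rewrite /V; case: insub => [j|]; [exact: Upf | exact: prime_filter0].
- rewrite /V; case: insub => [j|]; last by right=> y [].
  exact: kalman_neg (Upf j).
- apply/seteqP; split=> [y Fy|y [i _]]; last first.
    by rewrite /V; case: insub => // j; exact: upset_meetl.
  have [i Uy] : exists i, U i y.
    apply: contrapT => /forallNP Uy; apply: xmax.
    by apply: (orthogonal_extend Fx Fy) => i; rewrite meetC; exact: Uy.
  by exists (widen_ord km i) => //; rewrite /V /= valK.
Qed.

(** * Finite unions of prime filters *)

Section Bigcup.
Variables (I : finType) (U : I -> set L).
Hypothesis Upf : forall i, prime_filter (U i).

Lemma upset_bigcup : upset (\bigcup_i U i)%classic.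
Proof.
move=> x y [i _ Ux] xy; exists i => //.
by have [Uup _ _] := Upf i; exact: Uup Ux xy.
Qed.

Lemma prime_bigcup : prime_upset (\bigcup_i U i)%classic.
Proof.
split=> [|x y [i _ /(prime_filterU _ _ (Upf i))[]]]; first exact: upset_bigcup.
- by left; exists i.
- by right; exists i.
Qed.

(** The same [U i] serves on both sides: if complete, it contains the join of [y] and [dmneg y]; if
    consistent, it omits the meet of [x] and [dmneg x], so it must contain [u]. *)
Lemma kalman_bigcup :
    (forall i, neg_complete (U i) \/ neg_consistent (U i)) ->
  kalman (\bigcup_i U i)%classic.
Proof.
move=> Uneg; split=> [|x y z u [i _ Ui]]; first exact: upset_bigcup.
exists i => //; move: Ui.
rewrite !(prime_filterU, prime_filterI)//.
by case: (Uneg i) => [/(_ y)|/(_ x)]; tauto.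
Qed.

(** If the meet of [Y] is missed, each [U i] omits some [y i] in [Y]. These form a set of at most
    [#|I|] elements whose meet would lie in some [U i], hence so would [y i]. *)
Lemma n_filter_bigcup : (0 < #|I|)%N -> n_filter #|I| (\bigcup_i U i)%classic.
Proof.
move=> /card_gt0P[i0 _]; split=> [|Y y0 Yy0 UX]; first exact: upset_bigcup.
apply: contrapT => UY.
have /choice[y yP] : forall i, exists y, y \in Y /\ ~ U i y.
  move=> i; apply: contrapT => /forallNP Ui; apply: UY; exists i => //.
  apply: prime_filter_fmeet => // y Yy.
  by have /not_andP[//|/contrapT] := Ui y.
pose X := [fset y i | i in I]%fset.
have Xy i : y i \in X by rewrite in_imfset.
have [||i _ Ui] := UX X (y i0) (Xy i0).
- by apply/fsubsetP => _ /imfsetP[i _ ->]; case: (yP i).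
- by rewrite (leq_trans (leq_imfset_card _ _ _)) //= -cardE.
have [_] := yP i; apply; have [Uup _ _] := Upf i; apply: Uup Ui _.
exact: le_bigmeet.
Qed.

End Bigcup.

(** * Homomorphisms into [P1], [K1] and [PK i j] *)

Definition dm_char U x : DM1 :=
  match `[< U x >], `[< U (dmneg x) >] with
  | true, true => dm_b
  | true, false => dm_t
  | false, true => dm_f
  | false, false => dm_n
  end.

(** A value encodes the truth of [U x] and of [U (dmneg x)]. Meet acts as conjunction on the first
    and disjunction on the second, join dually, and negation swaps them. *)
Lemma dm_char_hom U : prime_filter U -> dm_hom (dm_char U).
Proof.
move=> Upf.
have UI x y : `[< U (x `&` y) >] = `[< U x >] && `[< U y >].
  by rewrite -asbool_and; apply: asbool_equiv_eq; exact: prime_filterI.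
have UU x y : `[< U (x `|` y) >] = `[< U x >] || `[< U y >].
  by rewrite -asbool_or; apply: asbool_equiv_eq; exact: prime_filterU.
split=> [x y|x y|x]; rewrite /dm_char ?dmnegI ?dmnegU ?dmnegK ?UI ?UU.
- by do 4!case: asboolP => _.
- by do 4!case: asboolP => _.
- by do 2!case: asboolP => _.
Qed.

(** Completeness excludes the value [dm_n]. *)
Lemma prime_filter_P1 U : prime_filter U -> neg_complete U ->
  exists h : L -> algebra P1, dm_hom h /\ forall x, U x <-> designated P1 (h x).
Proof.
move=> Upf Uneg; have [hI hU hN] := dm_char_hom Upf.
have hP x : dm_char U x \in P1_pred.
  rewrite /dm_char; case: asboolP; case: asboolP => // ? ?.
  by case: (Uneg x).
exists (fun x => exist _ (dm_char U x) (hP x)); split.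
  by split=> [x y|x y|x]; apply: val_inj; [exact: hI|exact: hU|exact: hN].
move=> x /=; rewrite /dm_char.
by case: asboolP; case: asboolP => ? ?; split=> //; do ?[by case | by auto].
Qed.

(** Consistency excludes [dm_b], leaving [dm_t] as the only value with [U x]. *)
Lemma prime_filter_K1 U : prime_filter U -> neg_consistent U ->
  exists h : L -> algebra K1, dm_hom h /\ forall x, U x <-> designated K1 (h x).
Proof.
move=> Upf Uneg; have [hI hU hN] := dm_char_hom Upf.
have hP x : dm_char U x \in K1_pred.
  rewrite /dm_char; case: asboolP; case: asboolP => // ? ?.
  by case: (Uneg x).
exists (fun x => exist _ (dm_char U x) (hP x)); split.
  by split=> [x y|x y|x]; apply: val_inj; [exact: hI|exact: hU|exact: hN].
move=> x /=; rewrite /dm_char.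
by case: asboolP; case: asboolP => ? ?; split=> // ?; case: (Uneg x).
Qed.

Lemma bigcup_PK n (U : 'I_n -> set L) :
    (forall i, prime_filter (U i)) ->
    (forall i, neg_complete (U i) \/ neg_consistent (U i)) ->
  exists i j : nat, (i + j)%N = n /\
    exists h : L -> algebra (PK i j),
      dm_hom h /\ (\bigcup_i U i = h @^-1` designated (PK i j))%classic.
Proof.
(* Complete members are sent to [P1] factors; all others are consistent and go to [K1] factors. *)
move=> Upf Uneg; pose T := [set i | `[< neg_complete (U i) >]]%SET.
exists #|T|, #|~: T|; split; first by rewrite cardsC card_ord.
have /choice[p pP] : forall a : 'I_#|T|, exists h : L -> algebra P1,
    dm_hom h /\ forall x, U (enum_val a) x <-> designated P1 (h x).
  move=> a; apply: prime_filter_P1 => //.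
  by have := enum_valP a; rewrite inE => /asboolP.
have /choice[q qP] : forall a : 'I_#|~: T|, exists h : L -> algebra K1,
    dm_hom h /\ forall x, U (enum_val a) x <-> designated K1 (h x).
  move=> a; apply: prime_filter_K1 => //.
  by have := enum_valP a; rewrite !inE => /asboolP; case: (Uneg (enum_val a)).
exists (fun x k =>
  match k return algebra (match k with inl _ => P1 | inr _ => K1 end) with
  | inl a => p a x
  | inr a => q a x
  end); split.
  split=> [x y|x y|x]; apply: functional_extensionality_dep => -[] a.
  - by have [[->]] := pP a.
  - by have [[->]] := qP a.
  - by have [[_ ->]] := pP a.
  - by have [[_ ->]] := qP a.
  - by have [[_ _ ->]] := pP a.
  - by have [[_ _ ->]] := qP a.
apply/seteqP; split=> [x [i _ Ux]|x [[a|a] _]].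
- have [iT|iT] := boolP (i \in T).
    exists (inl (enum_rank_in iT i)) => //=.
    by apply/(pP _).2; rewrite enum_rankK_in.
  have {}iT : i \in ~: T by rewrite inE.
  exists (inr (enum_rank_in iT i)) => //=.
  by apply/(qP _).2; rewrite enum_rankK_in.
- by move=> /(pP a).2; exists (enum_val a).
- by move=> /(qP a).2; exists (enum_val a).
Qed.

End PrimeFilters.

(** * The designated sets of [P1] and [K1], and the characterization *)

Lemma prime_filter_P1_designated : prime_filter (designated P1).
Proof.
split=> [[x xP] [y yP]|[x xP] [y yP]|[x xP] [y yP]] /=.
- by case: x y xP yP => [] [] //= *; intuition.
- by case: x y xP yP => [] [] //= *; intuition.
- by case: x y xP yP => [] [] //= *; intuition.
Qed.

Lemma prime_filter_K1_designated : prime_filter (designated K1).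
Proof.
split=> [[x xP] [y yP]|[x xP] [y yP]|[x xP] [y yP]] /=.
- by case: x y xP yP => [] [].
- by move=> -> ->.
- by case: x y xP yP => [] [] //= *; intuition.
Qed.

Lemma neg_complete_P1 : neg_complete (designated P1).
Proof. by case=> -[] //= *; intuition. Qed.

Lemma neg_consistent_K1 : neg_consistent (designated K1).
Proof. by case=> -[] //= ? []. Qed.

Lemma prime_filter_preimage (d d' : Order.disp_t) (L : deMorganType d)
    (M : deMorganType d') (h : L -> M) (U : set M) :
  dm_hom h -> prime_filter U -> prime_filter (h @^-1` U)%classic.
Proof.
move=> [hI hU _] [Uup UI UU]; split=> [x y Ux xy|x y|x y] /=.
- by apply: Uup Ux _; rewrite -(meet_l xy) hI; exact: leIr.
- by rewrite hI; exact: UI.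
- by rewrite hU; exact: UU.
Qed.

Theorem mainTheorem3 (n : nat) (hn : (1 <= n)%N) (d : Order.disp_t)
    (L : deMorganType d) (F : set L) :
  [/\ n_filter n F, prime_upset F & kalman F] <->
  exists i j : nat,
    [/\ (0 <= i <= n)%N, (0 <= j <= n)%N, (i + j)%N = n &
        exists h : L -> algebra (PK i j),
          dm_hom h /\ F = (h @^-1` designated (PK i j))%classic].
Proof.
split=> [[Fn Fp Fkal]|[i [j [_ _ ijn [h [[hI hU hN] ->]]]]]].
  have [U [Upf Uneg ->]] := kalman_prime_n_filter_bigcup hn Fn Fp Fkal.
  have [i [j [ijn hij]]] := bigcup_PK Upf Uneg.
  by exists i, j; split=> //; rewrite -ijn ?leq_addr ?leq_addl.
(* Conversely, the preimage is the union over the [n] coordinates of the prime filters [U k], so the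
   results on finite unions apply. *)
pose S (k : 'I_i + 'I_j) := match k with inl _ => P1 | inr _ => K1 end.
pose U k := ((fun x => h x k) @^-1` designated (S k))%classic.
have hk k : dm_hom (fun x => h x k : algebra (S k)).
  by split=> [x y|x y|x]; rewrite ?hI ?hU ?hN.
have Upf k : prime_filter (U k).
  apply: prime_filter_preimage; first exact: hk.
  case: k => a; [exact: prime_filter_P1_designated|].
  exact: prime_filter_K1_designated.
have Uneg k : neg_complete (U k) \/ neg_consistent (U k).
  case: k => a; [left|right] => x; rewrite /U /= hN.
    exact: (neg_complete_P1 (h x (inl a))).
  exact: (@neg_consistent_K1 (h x (inr a))).
have cn : #|{: 'I_i + 'I_j}| = n by rewrite card_sum !card_ord.
have -> : (h @^-1` designated (PK i j) = \bigcup_k U k)%classic by [].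
rewrite -{1}cn; split; [|exact: prime_bigcup|exact: kalman_bigcup].
by apply: n_filter_bigcup; rewrite // cn.
Qed.
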